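(* Let the $n\times n$ singular matrices $A$ and $B$ be $[n-m_B(0)]$-complementary with $$\theta=\sum_{i_1,\ldots,i_{n-m_B(0)}}\det N(i_1,i_2,\ldots,i_{n-m_B(0)})\neq 0,$$ where the sum is over all possible combinations $i_1,\ldots,i_{n-m_B(0)}$ of $n-m_B(0)$ of the indices $1,2,\ldots,n$. If $A$ and $B$ satisfy the Craig-Sakamoto (CS) equation $\det(I-sA-tB)=\det(I-sA)\,\det(I-tB)$ for all scalars $s,t$, then $$m_A(0)+m_B(0)=n.$$
   Context: $A$ and $B$ are $n\times n$ matrices with elements in $\mathbb{C}$, and $I$ is the $n\times n$ identity matrix. For a matrix $X$, $m_X(\lambda)$ denotes the algebraic multiplicity of $\lambda$ as an eigenvalue of $X$. Definition of $r$-complementary: $A$ and $B$ are called $r$-complementary if and only if at most $r$ rows (columns) $a_{i_1},a_{i_2},\ldots,a_{i_r}$ of $A$ are shifted and substituted by the corresponding rows (columns) $b_{i_1},b_{i_2},\ldots,b_{i_r}$ of $B$, such that the structured matrix $N(i_1,i_2,\ldots,i_r)$ of $a$'s and $b$'s rows is nonsingular. Here $N(i_1,\ldots,i_r)$ is the matrix obtained from $A$ by substituting its rows with indices $i_1,\ldots,i_r$ by the rows of $B$ with the same indices. *)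

(* Defs.v *)
From mathcomp Require Import all_boot all_order all_algebra.
From mathcomp Require Import complex reals.

Set Implicit Arguments.
Unset Strict Implicit.
Unset Printing Implicit Defensive.

Import GRing.Theory.
Local Open Scope ring_scope.

Definition alg_mult (F : fieldType) (n : nat) (X : 'M[F]_n) (lambda : F) : nat :=
  mup lambda (char_poly X).

(* A combination i_1, ..., i_r of r indices is encoded as a set S of
   cardinality r. *)
Definition rows_subst (F : fieldType) (n : nat) (A B : 'M[F]_n)
    (S : {set 'I_n}) : 'M[F]_n :=
  \matrix_(i < n) (if i \in S then row i B else row i A).

Definition complementary (F : fieldType) (n : nat) (r : nat)
    (A B : 'M[F]_n) : Prop :=
  exists2 S : {set 'I_n}, (#|S| <= r)%N & rows_subst A B S \in unitmx.

Definition sum_det_rows_subst (F : fieldType) (n : nat) (r : nat)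
    (A B : 'M[F]_n) : F :=
  \sum_(S : {set 'I_n} | #|S| == r) \det (rows_subst A B S).

Definition craig_sakamoto (F : fieldType) (n : nat) (A B : 'M[F]_n) : Prop :=
  forall s t : F,
    \det (1%:M - s *: A - t *: B) = \det (1%:M - s *: A) * \det (1%:M - t *: B).

(* Main.v *)
Require Import Defs.
From mathcomp Require Import all_boot all_order all_algebra.
From mathcomp Require Import complex reals.

Import GRing.Theory.

Local Open Scope ring_scope.

(** Expanding in rows, [\det (A + t B)] is a polynomial in [t] whose coefficient
    of degree [n - m_B(0)] is theta, so [A + t B] is nonsingular for some
    [t <> 0].  Homogenizing the Craig-Sakamoto equation along the line [(1, t)]
    gives ['X^n * char_poly (A + t B) = char_poly A * char_poly (t B)], and it
    remains to compare the orders of vanishing at 0. *)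

(** In each Leibniz product, the factor of row [i] is a sum of an entry of [A] and one of [t *: B];
    distributing amounts to choosing the set [S] of rows taken from [B]. *)
Lemma det_addZ_rows_subst (F : fieldType) (n : nat) (A B : 'M[F]_n) (t : F) :
  \det (A + t *: B) =
    \sum_(S : {set 'I_n}) t ^+ #|S| * \det (rows_subst A B S).
Proof.
rewrite /determinant; under [RHS]eq_bigr do rewrite mulr_sumr.
rewrite exchange_big; apply: eq_bigr => s _ /=.
(* With the [B] term first, [bigA_distr] lets [S] index the rows of [B]. *)
under eq_bigr do rewrite !mxE addrC.
rewrite bigA_distr mulr_sumr; apply: eq_big => [S|S _]; first by rewrite inE.
rewrite mulrCA; congr (_ * _).
rewrite -prodr_const [X in X * _]big_mkcond -big_split /=; apply: eq_bigr => i _.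
by rewrite !mxE; case: (i \in S); rewrite !mxE ?mul1r.
Qed.

Lemma horner_char_poly (F : fieldType) (n : nat) (M : 'M[F]_n) (u : F) :
  (char_poly M).[u] = \det (u%:M - M).
Proof.
rewrite -[LHS]/(horner_eval u _) /char_poly -det_map_mx; congr (\det _).
by apply/matrixP => i j; rewrite !mxE /= /horner_eval hornerD hornerN hornerMn hornerX hornerC.
Qed.

Lemma eq_poly_neq0 (F : closedFieldType) (p q : {poly F}) :
  (forall x : F, x != 0 -> p.[x] = q.[x]) -> p = q.
Proof.
move=> eq_pq; apply/eqP; rewrite -subr_eq0; apply/negPn/negP => pq_neq0.
(* The factor ['X] forces the nonroot to be nonzero. *)
have /closed_nonrootP[x] : (p - q) * 'X != 0 by rewrite mulf_neq0 ?polyX_eq0.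
rewrite rootM negb_or !rootE hornerX => /andP[+ /eq_pq pqx].
by rewrite hornerD hornerN pqx subrr eqxx.
Qed.

(** Pull [t] out of each of the [n] rows of ['X - t *: M]. *)
Lemma char_polyZ (F : fieldType) (n : nat) (M : 'M[F]_n) (t : F) : t != 0 ->
  char_poly (t *: M) = t ^+ n *: (char_poly M \Po (t^-1 *: 'X)).
Proof.
move=> t_neq0; rewrite /char_poly -[_ \Po _]det_map_mx -mul_polyC rmorphXn /=.
rewrite -detZ; congr (\det _); apply/matrixP => i j.
rewrite !mxE comp_polyB raddfMn /= comp_polyX comp_polyC mulrBr polyCM.
by rewrite mulrnAr [_ * (_ *: _)]mul_polyC scalerA mulfV // scale1r.
Qed.

Lemma mup_Xn (F : fieldType) (n : nat) : mup 0 ('X^n : {poly F}) = n.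
Proof. by rewrite -['X]subr0 -polyC0 mup_XsubCX eqxx. Qed.

(** The substitution of [t^-1 *: 'X] for ['X] fixes 0: it turns [q * 'X^m] with [q.[0] != 0] into a
    product of the same shape, up to a nonzero scalar. *)
Lemma alg_multZ (F : fieldType) (n : nat) (M : 'M[F]_n) (t : F) : t != 0 ->
  alg_mult (t *: M) 0 = alg_mult M 0.
Proof.
move=> t_neq0; rewrite /alg_mult char_polyZ //.
have [m [q]] := multiplicity_XsubC (char_poly M) 0.
rewrite monic_neq0 ?char_poly_monic //= polyC0 subr0 => nrq ->.
rewrite comp_polyM comp_Xn_poly exprZn -scalerAr scalerA -mul_polyC.
rewrite mulrA !mupMr ?mup_Xn //.
rewrite rootM negb_or rootC mulf_neq0 ?expf_neq0 ?invr_eq0 //=.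
by rewrite rootE horner_comp hornerZ hornerX mulr0.
Qed.

Lemma craig_sakamoto_char_poly (F : closedFieldType) (n : nat)
    (A B : 'M[F]_n) (t : F) : craig_sakamoto A B ->
  'X^n * char_poly (A + t *: B) = char_poly A * char_poly (t *: B).
Proof.
move=> CS; apply: eq_poly_neq0 => u u_neq0.
rewrite !hornerM hornerXn !horner_char_poly.
(* This brings in the Craig-Sakamoto equation at [(u^-1, u^-1 * t)]; the powers [u ^+ n] match
   thanks to ['X^n]. *)
have scal (M : 'M[F]_n) : u%:M - M = u *: (1%:M - u^-1 *: M).
  by rewrite scalerBr scalerA mulfV // scale1r scalemx1.
rewrite !scal !detZ scalerDr opprD addrA scalerA CS.
by rewrite [RHS]mulrACA -mulrA.
Qed.

Lemma craig_sakamoto_alg_mult (F : closedFieldType) (n r : nat)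
    (A B : 'M[F]_n) :
  sum_det_rows_subst r A B != 0 -> craig_sakamoto A B ->
  (alg_mult A 0 + alg_mult B 0)%N = n.
Proof.
move=> theta_neq0 CS.
pose p : {poly F} := \sum_(S : {set 'I_n}) \det (rows_subst A B S) *: 'X^#|S|.
have p_neq0 : p != 0.
  apply: contraNneq theta_neq0 => p0.
  have := coef0 F r; rewrite -p0 coef_sum => <-.
  rewrite /sum_det_rows_subst big_mkcond; apply/eqP/eq_bigr => S _.
  by rewrite coefZ coefXn eq_sym; case: eqP; rewrite ?mulr1 ?mulr0.
(* Again ['X] gives [t != 0], so that [t *: B] and [B] have the same multiplicity at 0. *)
have /closed_nonrootP[t] : p * 'X != 0 by rewrite mulf_neq0 ?polyX_eq0.
rewrite rootM negb_or !rootE hornerX => /andP[pt_neq0 t_neq0].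
have det_neq0 : \det (A + t *: B) != 0.
  rewrite det_addZ_rows_subst; move: pt_neq0; rewrite horner_sum.
  by under eq_bigr do rewrite hornerZ hornerXn mulrC.
have char_neq0 (M : 'M[F]_n) : char_poly M != 0.
  by rewrite monic_neq0 ?char_poly_monic.
rewrite -(alg_multZ _ _ B t) // /alg_mult -mupM // -craig_sakamoto_char_poly //.
(* At 0, [char_poly (A + t *: B)] is the nonzero determinant up to sign, so ['X^n] alone contributes
   to the order. *)
rewrite mupMl ?mup_Xn //.
rewrite rootE horner_char_poly raddf0 sub0r -scaleN1r detZ mulf_neq0 //.
by rewrite expf_neq0 // oppr_eq0 oner_eq0.
Qed.

Theorem proposition4 (R : realType) (n : nat) (A B : 'M[R[i]]_n)
  (singA : A \notin unitmx) (singB : B \notin unitmx)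
  (complAB : complementary (n - alg_mult B 0)%N A B)
  (theta_neq0 : sum_det_rows_subst (n - alg_mult B 0)%N A B != 0)
  (CS : craig_sakamoto A B) :
  (alg_mult A 0 + alg_mult B 0 = n)%N.
Proof. exact: craig_sakamoto_alg_mult theta_neq0 CS. Qed.
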